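(* Two pointed models $(\mathcal{M},s)$ and $(\mathcal{M}',s')$ satisfy the same formulas of $\mathcal{L}_1$ if and only if they are bisimilar.
   Context: Fix a set of constants $\mathbb{C}$. The language $\mathcal{L}_1$ is given by $\varphi ::= \top \mid \lnot\varphi \mid \varphi\land\varphi \mid \mathit{Kv}(c) \mid [c]\varphi$ with $c\in\mathbb{C}$. A model is $\mathcal{M}=\langle S,\mathcal{D},V\rangle$ with $S$ a non-empty set of states, $\mathcal{D}$ a non-empty domain, $V:S\times\mathbb{C}\to\mathcal{D}$; $s=_c t$ means $V(s,c)=V(t,c)$, $s\neq_c t$ its negation, and $s=_C t$ means $s=_c t$ for all $c\in C$. Semantics: booleans as usual; $\mathcal{M},s\vDash\mathit{Kv}(c)$ iff $s=_c t$ for all $t\in S$; $\mathcal{M},s\vDash[c]\varphi$ iff $\mathcal{M}|^s_c,s\vDash\varphi$, where $\mathcal{M}|^s_c=\langle S',\mathcal{D},V|_{S'\times\mathbb{C}}\rangle$ with $S'=\{t\in S\mid s=_c t\}$. Pointed models $(\langle S,\mathcal{D},V\rangle,s)$ and $(\langle S',\mathcal{D}',V'\rangle,s')$ are bisimilar iff (i) for every finite $C\subseteq\mathbb{C}$ and every $d\in\mathbb{C}$, if there is $t\in S$ with $s=_C t$ and $s\neq_d t$, then there is $t'\in S'$ with $s'=_C t'$ and $s'\neq_d t'$; and (ii) vice versa. *)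

(* Defs.v *)
From Stdlib Require Export Ensembles Finite_sets.
Set Implicit Arguments.
Unset Strict Implicit.

Inductive formula (Const : Type) : Type :=
  | Top : formula Const
  | Neg : formula Const -> formula Const
  | And : formula Const -> formula Const -> formula Const
  | Kv : Const -> formula Const
  | Insp : Const -> formula Const -> formula Const. (* [c]phi *)
Arguments Top {Const}.

Record model (Const : Type) : Type := Model {
  state : Type;
  domain : Type;
  val : state -> Const -> domain;
  state_nonempty : inhabited state;
  domain_nonempty : inhabited domain
}.

(* s =_c t *)
Definition eq_at (Const : Type) (M : model Const) (c : Const)
    (s t : state M) : Prop :=
  val s c = val t c.

(* s =_C t *)
Definition eq_on (Const : Type) (M : model Const) (C : Ensemble Const)
    (s t : state M) : Prop :=
  forall c : Const, In Const C c -> eq_at c s t.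

(* States of M|^s_c carry a proof of s =_c t, which is irrelevant to every notion
   below. *)
Definition restr_state (Const : Type) (M : model Const) (s : state M)
    (c : Const) : Type :=
  {t : state M | eq_at c s t}.

Definition restr_point (Const : Type) (M : model Const) (s : state M)
    (c : Const) : restr_state s c :=
  exist (fun t => eq_at c s t) s eq_refl.

(* M|^s_c *)
Definition restr (Const : Type) (M : model Const) (s : state M) (c : Const) :
    model Const :=
  {| state := restr_state s c;
     domain := domain M;
     val := fun t => val (proj1_sig t);
     state_nonempty := inhabits (restr_point s c);
     domain_nonempty := domain_nonempty M |}.

Fixpoint sat (Const : Type) (phi : formula Const) (M : model Const)
    (s : state M) {struct phi} : Prop :=
  match phi with
  | Top => True
  | Neg psi => ~ sat psi s
  | And psi chi => sat psi s /\ sat chi s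
  | Kv c => forall t : state M, eq_at c s t
  | Insp c psi => @sat Const psi (restr s c) (restr_point s c)
  end.

Definition same_formulas (Const : Type) (M M' : model Const)
    (s : state M) (s' : state M') : Prop :=
  forall phi : formula Const, sat phi s <-> sat phi s'.

Definition simulated (Const : Type) (M M' : model Const)
    (s : state M) (s' : state M') : Prop :=
  forall (C : Ensemble Const) (d : Const), Finite Const C ->
    (exists t : state M, eq_on C s t /\ ~ eq_at d s t) ->
    (exists t' : state M', eq_on C s' t' /\ ~ eq_at d s' t').

Definition bisimilar (Const : Type) (M M' : model Const)
    (s : state M) (s' : state M') : Prop :=
  simulated s s' /\ simulated s' s.

(* Main.v *)
(** Inspecting all [c] in a finite [C] restricts the model to the states agreeing
    with the current one on [C], so a chain of inspections followed by [Kv d]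
    expresses that no state separates [d] while agreeing on [C]; these are exactly
    the facts compared by bisimilarity. Conversely, inspecting [c] turns such a
    fact for [C] into one for [C] together with [c], so bisimilarity is preserved
    by inspection, and formula induction applies. *)

From Stdlib Require Import Classical.
Require Import Defs.

Lemma eq_on_Add (Const : Type) (M : model Const) (C : Ensemble Const)
    (c : Const) (s t : state M) :
  eq_on (Add Const C c) s t <-> eq_on C s t /\ eq_at c s t.
Proof.
  split.
  - intros H. split.
    + intros x Hx. apply H. now left.
    + apply H. right. constructor.
  - intros [HC Hc] x [y Hy | y Hy].
    + now apply HC.
    + now destruct Hy.
Qed.

(** The formula is chosen before the model, so that the same one can be tested at points of two
    models. *)
Lemma Kv_given_definable (Const : Type) (C : Ensemble Const) (d : Const) :
  Finite Const C ->
  exists phi : formula Const, forall (M : model Const) (s : state M),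
    sat phi s <-> forall t : state M, eq_on C s t -> eq_at d s t.
Proof.
  intros HC. induction HC as [|C _ [phi IH] c _].
  - exists (Kv d). intros M s. split.
    + intros H t _. apply H.
    + intros H t. apply H. intros x [].
  - exists (Insp c phi). intros M s. simpl. rewrite IH. split.
    + intros H t Ht. apply eq_on_Add in Ht. destruct Ht as [HCt Hct].
      exact (H (exist _ t Hct) HCt).
    + intros H [t Hct] HCt. apply (H t), eq_on_Add. now split.
Qed.

Lemma same_formulas_simulated (Const : Type) (M M' : model Const)
    (s : state M) (s' : state M') :
  same_formulas s s' -> simulated s s'.
Proof.
  intros H C d HC [t [Ht Hd]].
  destruct (Kv_given_definable Const C d HC) as [phi Hphi].
  (* Without a suitable [t'], [phi] would hold at [s'], hence at [s], against the choice of [t]. *)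
  apply NNPP. intros Hno. apply Hd.
  apply (proj1 (Hphi M s)); [|exact Ht].
  apply H, Hphi. intros t' Ht'. apply NNPP. intros Hd'.
  apply Hno. now exists t'.
Qed.

Lemma simulated_restr (Const : Type) (M M' : model Const)
    (s : state M) (s' : state M') (c : Const) :
  simulated s s' ->
  @simulated Const (restr s c) (restr s' c) (restr_point s c) (restr_point s' c).
Proof.
  intros H C d HC [[t Hct] [HCt Hd]].
  assert (Ht' : exists t', eq_on (Add Const C c) s' t' /\ ~ eq_at d s' t').
  { (* [Add_preserves_Finite] would avoid the case split, but it relies on the
       axiom [Extensionality_Ensembles]. *)
    destruct (classic (In Const C c)) as [Hin | Hnin].
    - destruct (H C d HC) as [t' [HCt' Hd']]; [now exists t|].
      (* As [c] lies in [C], agreement on [C] includes agreement at [c]. *)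
      exists t'. split; [|exact Hd']. apply eq_on_Add. split; auto.
    - apply H; [now constructor|].
      exists t. split; [|exact Hd]. apply eq_on_Add. now split. }
  destruct Ht' as [t' [Ht' Hd']]. apply eq_on_Add in Ht'.
  destruct Ht' as [HCt' Hct']. exists (exist _ t' Hct'). now split.
Qed.

Lemma simulated_Kv (Const : Type) (M M' : model Const)
    (s : state M) (s' : state M') (c : Const) :
  simulated s s' -> sat (Kv c) s' -> sat (Kv c) s.
Proof.
  intros H Hs' t. apply NNPP. intros Hc.
  (* Agreement on the empty set is vacuous. *)
  destruct (H (Empty_set Const) c) as [t' [_ Hc']].
  - constructor.
  - exists t. split; [intros x [] | exact Hc].
  - exact (Hc' (Hs' t')).
Qed.

Lemma bisimilar_same_formulas (Const : Type) (M M' : model Const)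
    (s : state M) (s' : state M') :
  bisimilar s s' -> same_formulas s s'.
Proof.
  (* The models must vary: the [Insp] case uses the induction hypothesis at their restrictions. *)
  intros H phi. revert M M' s s' H.
  induction phi as [|phi IH|phi IHphi psi IHpsi|c|c phi IH];
    intros M M' s s' H; simpl.
  - tauto.
  - now rewrite (IH M M' s s' H).
  - now rewrite (IHphi M M' s s' H), (IHpsi M M' s s' H).
  - destruct H as [H H']. split; now apply simulated_Kv.
  - destruct H as [H H']. apply IH. split; now apply simulated_restr.
Qed.

Theorem theorem2 (Const : Type) (M M' : model Const)
    (s : state M) (s' : state M') :
  same_formulas s s' <-> bisimilar s s'.
Proof.
  split.
  - intros H. split; apply same_formulas_simulated; [exact H|].
    intros phi. symmetry. apply H.
  - apply bisimilar_same_formulas.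
Qed.
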